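(* Ultrametric 1-median has a Monte Carlo $O((\log^2(1/\epsilon))/\epsilon^3)$-time $(1+\epsilon)$-approximation algorithm with success probability greater than $1-\epsilon$, for all $\epsilon>0$.
   Context: An ultrametric space is a nonempty set $M$ with a distance function $d\colon M\times M\to[0,\infty)$ such that $d(x,y)=0$ iff $x=y$, $d(x,y)=d(y,x)$, and $d(x,z)\le\max\{d(x,y),d(y,z)\}$ for all $x,y,z\in M$. The problem Ultrametric 1-median is: given an $n$-point ultrametric space $([n],d)$ (with distances accessible by queries), find a point in $[n]$ (a 1-median) minimizing the average distance $\frac{1}{n}\sum_{j=1}^n d(x,j)$ to all points. A $\kappa$-approximate 1-median is a point whose average distance to all points is at most $\kappa$ times the minimum. The running time bound is independent of $n$. *)

(* Defs.v *)
From HB Require Import structures.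
From mathcomp Require Import all_boot all_order all_algebra.
From mathcomp Require Import reals exp.

Set Implicit Arguments.
Unset Strict Implicit.
Unset Printing Implicit Defensive.

Import Order.TTheory GRing.Theory Num.Theory.
Local Open Scope ring_scope.

(* The point set [n] is 'I_n, that is, {0, ..., n-1}. *)
Record ultrametric (R : realType) (n : nat) (d : 'I_n -> 'I_n -> R) : Prop :=
  Ultrametric {
    um_ge0 : forall x y, 0 <= d x y;
    um_eq0 : forall x y, d x y = 0 <-> x = y;
    um_sym : forall x y, d x y = d y x;
    um_max : forall x y z, d x z <= Num.max (d x y) (d y z) }.

Definition avg_dist (R : realType) (n : nat) (d : 'I_n -> 'I_n -> R)
    (x : 'I_n) : R :=
  n%:R^-1 * \sum_(j < n) d x j.

Definition median1 (R : realType) (n : nat) (d : 'I_n -> 'I_n -> R)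
    (y : 'I_n) : bool :=
  [forall z, avg_dist d y <= avg_dist d z].

(* For a 1-median y, avg_dist d y is the minimum average distance. *)
Definition approx_median1 (R : realType) (n : nat) (d : 'I_n -> 'I_n -> R)
    (kappa : R) (x : 'I_n) : bool :=
  [exists y, median1 d y && (avg_dist d x <= kappa * avg_dist d y)].

(* A unit-cost randomized real RAM with access to a distance oracle.  It has
   two infinite arrays of cells: N holds natural numbers (points of [n],
   counters, addresses) and V holds real numbers.  Distances are accessible only
   through IQuery.  No instruction converts between the two kinds of cells, so
   in particular reals cannot be rounded.  All operands are literals of the
   program; the effect of each instruction is given by step below. *)
Inductive instr : Type :=
| INConst of nat & nat
| INAdd of nat & nat & nat
| INSub of nat & nat & nat
| INLoad of nat & nat
| INStore of nat & nat
| IVConst of nat & nat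
| IVAdd of nat & nat & nat
| IVSub of nat & nat & nat
| IVMul of nat & nat & nat
| IVDiv of nat & nat & nat
| IVLoad of nat & nat
| IVStore of nat & nat
| IRand of nat
| IQuery of nat & nat & nat
| IJump of nat
| IJumpNLt of nat & nat & nat
| IJumpVLt of nat & nat & nat
| IHalt.

Definition program := seq instr.

(* tape is the part of the random tape that has not been read yet. *)
Record state (R : realType) := State {
  pc : nat;
  nmem : nat -> nat;
  vmem : nat -> R;
  tape : seq nat }.

Definition upd (A : Type) (f : nat -> A) (i : nat) (a : A) : nat -> A :=
  fun j => if j == i then a else f j.

(* Queries at numbers that are not points of [n] return 0. *)
Definition oracle (R : realType) (n : nat) (d : 'I_n -> 'I_n -> R)
    (a b : nat) : R :=
  match insub a, insub b with
  | Some x, Some y => d x y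
  | _, _ => 0
  end.

(* Falling off the end of the program is the same as halting. *)
Definition fetch (prog : program) (l : nat) : instr := nth IHalt prog l.

Definition step (R : realType) (q : nat -> nat -> R) (prog : program)
    (s : state R) : state R :=
  let: State l N V w := s in
  let setN i c := State l.+1 (upd N i c) V w in
  let setV i c := State l.+1 N (upd V i c) w in
  let jump (b : bool) l' := State (if b then l' else l.+1) N V w in
  match fetch prog l with
  | INConst i c => setN i c
  | INAdd i j k => setN i (N j + N k)%N
  | INSub i j k => setN i (N j - N k)%N
  | INLoad i j => setN i (N (N j))
  | INStore i j => setN (N i) (N j)
  | IVConst i c => setV i c%:R
  | IVAdd i j k => setV i (V j + V k)
  | IVSub i j k => setV i (V j - V k)
  | IVMul i j k => setV i (V j * V k)
  | IVDiv i j k => setV i (V j / V k)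
  | IVLoad i j => setV i (V (N j))
  | IVStore i j => setV (N i) (V j)
  | IRand i => State l.+1 (upd N i (head 0%N w)) V (behead w)
  | IQuery i j k => setV i (q (N j) (N k))
  | IJump l' => jump true l'
  | IJumpNLt i j l' => jump (N i < N j)%N l'
  | IJumpVLt i j l' => jump (V i < V j) l'
  | IHalt => s
  end.

Definition halted (R : realType) (prog : program) (s : state R) : bool :=
  if fetch prog (pc s) is IHalt then true else false.

(* The input is n in N[0] and eps in V[0]; all other cells start at 0. *)
Definition init (R : realType) (n : nat) (eps : R) (w : seq nat) : state R :=
  State 0 (upd (fun _ => 0%N) 0 n) (upd (fun _ => 0) 0 eps) w.

(* The state after t steps.  At most one random point is drawn per step, so a
   tape of length t is never exhausted before t steps have been made. *)
Definition run (R : realType) (n : nat) (d : 'I_n -> 'I_n -> R)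
    (prog : program) (eps : R) (t : nat) (w : t.-tuple 'I_n) : state R :=
  iter t (step (oracle d) prog) (init n eps [seq val i | i <- w]).

(* The output is N[0]; a value that is not a point of [n] counts as failure. *)
Definition outputs (R : realType) (n : nat) (P : pred 'I_n) (s : state R) :
    bool :=
  if insub (nmem s 0) is Some x then P x else false.

Definition tape_prob (R : realType) (n t : nat) (E : pred (t.-tuple 'I_n)) : R :=
  #|[set w | E w]|%:R / #|{: t.-tuple 'I_n}|%:R.

(* Main.v *)
(* Put e = min(eps, 1/2) and let y be a 1-median.  If x is a point outside of
   the set G of (1 + e/3)-approximate medians that is nearest to y, the strong
   triangle inequality shows that replacing y by x increases d(_, j) only for j
   strictly closer to y than x, and all such j lie in G; hence G contains a
   fraction e/4 of the points, and O(log(1/e)/e) random candidates hit G.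
   For a point x that is not (1 + e)-approximate and g in G, the increments
   d(x, j) - d(g, j) are at most D = d(x, g) in absolute value and have mean at
   least e D / 5, so by Chernoff O(log(1/e)/e^2) samples j, shared by all
   candidates, tell x from g.  The candidate with the least sum of distances to
   the samples is the answer.  The machine cannot compute logarithms, so it finds
   both numbers of draws by multiplying by 1 - e/4, resp. 1 - e^2/200, until the
   product drops below e/4. *)
Require Import Defs.
From HB Require Import structures.
From mathcomp Require Import all_boot all_order all_algebra.
From mathcomp Require Import reals exp.
From mathcomp Require Import sequences ring lra zify.

Set Implicit Arguments.
Unset Strict Implicit.
Unset Printing Implicit Defensive.

Import Order.TTheory GRing.Theory Num.Theory.
Local Open Scope ring_scope.

(* V0 = e := min(eps, 1/2), V1 = 1, V2 = e / 4, V3 = 1 - e / 4, V4 = 0,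
   V5 = 1 - e^2 / 200, V6 = the decaying quantity of the current loop,
   V7 = 1 + the number of candidates still to be drawn at address 30,
   V8 = the score difference of the current candidate, N0 = the best candidate,
   N1 = the current one, N2 = 1, N6 = 0; the samples are stored from address 8
   up to N3 (excluded), and N4 runs through them.
   The leading numbers are the instruction addresses used by the jumps. *)
Definition median_prog : program := [::
  (* 0, constants *)
  IVConst 1 1; IVConst 2 2; IVDiv 3 1 2; IJumpVLt 0 3 5; IVAdd 0 3 4;
  (* 5 *)
  IVConst 2 4; IVDiv 2 0 2; IVSub 3 1 2;
  IVConst 5 200; IVMul 6 0 0; IVDiv 5 6 5; IVSub 5 1 5;
  IVConst 6 1; IVConst 7 1;
  (* 14, count the candidates: one more than the least k with V3^k < V2 *)
  IJumpVLt 6 2 18; IVMul 6 6 3; IVAdd 7 7 1; IJump 14;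
  (* 18 *)
  INConst 2 1; INConst 3 8; IVAdd 6 7 4;
  (* 21, draw samples until (k + 1) * V5^m < V2 *)
  IJumpVLt 6 2 27; IVMul 6 6 5; IRand 5; INStore 3 5; INAdd 3 3 2; IJump 21;
  (* 27 *)
  IRand 0;
  (* 28, loop over the remaining candidates *)
  IJumpVLt 1 7 30; IHalt;
  (* 30 *)
  IRand 1; INConst 4 8; IVConst 8 0;
  (* 33, loop over the samples *)
  IJumpNLt 4 3 37; IJumpVLt 8 4 44; IVSub 7 7 1; IJump 28;
  (* 37 *)
  INLoad 5 4; IQuery 9 1 5; IQuery 10 0 5; IVSub 9 9 10;
  IVAdd 8 8 9; INAdd 4 4 2; IJump 33;
  (* 44, replace the best candidate *)
  INAdd 0 1 6; IJump 35].

(** * Symbolic execution of the program, with step counts *)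

Definition score_diff (R : realType) (T : Type) (q : T -> T -> R) (s : seq T)
  (c b : T) : R := \sum_(j <- s) (q c j - q b j).

(** Functional model of the loop at address 28. Ties keep the incumbent, as the strict test in
    [IJumpVLt 8 4 44] does. The type [T] is generic because the rule is run both on machine numbers
    and on points. *)
Definition pick_best (R : realType) (T : Type) (q : T -> T -> R) (s : seq T) :=
  foldl (fun b c => if score_diff q s c b < 0 then c else b).

(** An upper bound on the step count, rather than its exact value, lets branches of different
    lengths share one budget. *)
Definition reach (R : realType) (q : nat -> nat -> R) (P : state R -> Prop)
    (T : nat) (s : state R) : Prop :=
  exists2 j, (j <= T)%N & P (iter j (step q median_prog) s).

Lemma reach0 (R : realType) (q : nat -> nat -> R) P T s : P s -> reach q P T s.
Proof. by exists 0%N. Qed.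

Lemma reach_step (R : realType) (q : nat -> nat -> R) P T s :
  reach q P T (step q median_prog s) -> reach q P T.+1 s.
Proof. by case=> j jT Pj; exists j.+1; rewrite // iterSr. Qed.

Lemma reach_le (R : realType) (q : nat -> nat -> R) P T T' s :
  (T <= T')%N -> reach q P T s -> reach q P T' s.
Proof. by move=> TT' [j jT Pj]; exists j; rewrite // (leq_trans jT). Qed.

Ltac exec := apply: reach_step; rewrite /=.

Definition prog_consts (R : realType) (e : R) (V : nat -> R) :=
  [/\ V 1%N = 1, V 2%N = e / 4, V 3%N = 1 - e / 4, V 4%N = 0 &
      V 5%N = 1 - e ^+ 2 / 200].

(** Continuation style: [cont] covers the run from address 18 on, so budgets add up. By induction on
    the rounds left, each round takes 4 steps and the exit test 1. *)
Lemma exec_count (R : realType) (q : nat -> nat -> R) P T (e : R) k N V w :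
  (1 - e / 4) ^+ k < e / 4 ->
  (forall i, (i < k)%N -> e / 4 <= (1 - e / 4) ^+ i) ->
  (forall V', prog_consts e V' -> V' 7%N = k.+1%:R ->
     reach q P T (State 18 N V' w)) ->
  forall j i, (i + j = k)%N -> prog_consts e V ->
  V 6%N = (1 - e / 4) ^+ i -> V 7%N = i.+1%:R ->
  reach q P (4 * j + T).+1 (State 14 N V w).
Proof.
move=> endk ltk cont j; elim: j V => [|j IH] V i ij cV V6 V7.
  exec; case: (cV) => V1 V2 _ _ _; rewrite V6 V2.
  rewrite addn0 in ij; rewrite ij endk; apply: cont => //.
  by rewrite V7 ij.
rewrite mulnSr addnAC [(_ + 4)%N]addn4.
exec; case: (cV) => V1 V2 V3 V4 V5; rewrite V6 V2 ltNge ltk /=; last first.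
  by rewrite -ij addnS ltnS leq_addr.
do 3 exec; apply: (IH _ i.+1); rewrite /prog_consts /upd /=.
- by rewrite addSnnS.
- by split.
- by rewrite V6 V3 exprSr.
- by rewrite V7 V1 natr1.
Qed.

Definition stored (s : seq nat) (N : nat -> nat) :=
  [/\ N 2 = 1, N 3 = 8 + size s, N 6 = 0 &
      forall i, (i < size s)%N -> N (8 + i) = nth 0 s i]%N.

(** Here [s0] holds the samples already stored and [s1] those still on the tape. A round takes 6
    steps. *)
Lemma exec_sample (R : realType) (q : nat -> nat -> R) P T (e : R) k m w :
  k.+1%:R * (1 - e ^+ 2 / 200) ^+ m < e / 4 ->
  (forall i, (i < m)%N -> e / 4 <= k.+1%:R * (1 - e ^+ 2 / 200) ^+ i) ->
  forall s1 s0 N V, size (s0 ++ s1) = m ->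
  (forall N' V', stored (s0 ++ s1) N' -> prog_consts e V' ->
     V' 7%N = k.+1%:R -> reach q P T (State 27 N' V' w)) ->
  stored s0 N -> prog_consts e V ->
  V 6%N = k.+1%:R * (1 - e ^+ 2 / 200) ^+ size s0 -> V 7%N = k.+1%:R ->
  reach q P (6 * size s1 + T).+1 (State 21 N V (s1 ++ w)).
Proof.
move=> endm ltm; elim=> [|x s1 IH] s0 N V szs cont sN cV V6 V7.
  rewrite cats0 in cont szs.
  exec; case: (cV) => V1 V2 _ _ _.
  by rewrite V6 V2 szs endm; apply: cont.
rewrite [size (_ :: _)]/= mulnSr addnAC.
rewrite (_ : (_ + 6).+1 = ((6 * size s1 + T).+1).+4.+2)%N; last first.
  by rewrite !addnS addn0.
exec; case: (cV) => V1 V2 V3 V4 V5; rewrite V6 V2 ltNge ltm /=; last first.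
  by rewrite -szs size_cat /= addnS ltnS leq_addr.
do 5 exec; rewrite -cat_rcons in szs cont *; apply: (IH _ _ _ szs cont) => //.
- case: sN => N2 N3 N6 Ns; split; rewrite /upd /= ?N2 ?N3 //.
  + by rewrite size_rcons addn1.
  + move=> i; rewrite size_rcons ltnS nth_rcons.
    rewrite eqn_add2l leq_eqVlt; case: eqVneq => [->|_] /=; first by rewrite ltnn.
    by move=> ilt; rewrite ilt Ns.
- by rewrite /upd /= V6 V5 size_rcons (exprSr _ (size _)) mulrA.
Qed.

Lemma exec_score (R : realType) (q : nat -> nat -> R) P T s b c V w :
  (forall N' V', stored s N' -> N' 0%N = b -> N' 1%N = c ->
    V' 1%N = V 1%N -> V' 4%N = V 4%N -> V' 7%N = V 7%N ->
    V' 8%N = score_diff q s c b -> reach q P T (State 34 N' V' w)) ->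
  forall s1 s0 N V', s = s0 ++ s1 -> stored s N -> N 0%N = b -> N 1%N = c ->
    N 4 = (8 + size s0)%N ->
    V' 1%N = V 1%N -> V' 4%N = V 4%N -> V' 7%N = V 7%N ->
    V' 8%N = score_diff q s0 c b ->
  reach q P (8 * size s1 + T).+1 (State 33 N V' w).
Proof.
move=> cont; elim=> [|x s1 IH] s0 N V' es sN N0 N1 N4 V1 V4 V7 V8.
  rewrite cats0 in es; subst s.
  exec; case: (sN) => N2 N3 N6 Ns.
  by rewrite N3 N4 ltnn; apply: cont.
rewrite (_ : (8 * size (x :: s1) + T).+1 = ((8 * size s1 + T).+1).+4.+4)%N; last first.
  by rewrite /= mulnSr addnAC !addnS addn0.
exec; case: (sN) => N2 N3 N6 Ns.
rewrite N3 N4 es size_cat /= ltn_add2l -{1}[size s0]addn0 ltn_add2l /=.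
do 7 exec; rewrite -cat_rcons in es; apply: (IH _ _ _ es) => //.
- by rewrite /upd /= N4 N2 size_rcons -addnA addn1.
- rewrite /upd /= N4 N0 N1 V8.
  have -> : N (8 + size s0)%N = x.
    rewrite Ns; last by rewrite es size_cat size_rcons; lia.
    by rewrite es nth_cat size_rcons ltnSn nth_rcons ltnn eqxx.
  by rewrite /score_diff -cats1 big_cat big_seq1.
Qed.

Lemma exec_best (R : realType) (q : nat -> nat -> R) s w :
  forall cs b N V, stored s N -> N 0%N = b -> V 1%N = 1 -> V 4%N = 0 ->
  V 7%N = (size cs).+1%:R ->
  reach q (fun s' => halted median_prog s' /\ nmem s' 0 = pick_best q s b cs)
    (size cs * (8 * size s + 10)).+1 (State 28 N V (cs ++ w)).
Proof.
elim=> [|c cs IH] b N V sN N0 V1 V4 V7.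
  by exec; rewrite V7 V1 ltxx; apply: reach0.
rewrite (_ : (_ * _).+1 =
  (8 * size s + (size cs * (8 * size s + 10)).+1.+4.+1).+1.+4)%N; last first.
  by rewrite /= mulSn; lia.
exec; rewrite V7 V1 ltr1n /=; do 3 exec.
apply: (exec_score (V := V) (s := s) (b := b) (c := c) _ (s1 := s) (s0 := [::])) => //.
- move=> N' V' sN' N'0 N'1 V'1 V'4 V'7 V'8.
  have V'7m : V' 7%N - V' 1%N = (size cs).+1%:R.
    by rewrite V'7 V'1 V7 V1 -[in LHS]natr1 addrK.
  exec; rewrite V'8 V'4 V4.
  case: ifP => neg /=.
    do 2 exec; do 2 exec.
    case: sN' => N'2 N'3 N'6 N's; apply: IH;
      rewrite /upd /= ?V'1 ?V'4 ?N'1 ?N'6 ?addn0 ?neg //.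
    by rewrite -V'1.
  (* Keeping the incumbent skips the two instructions at address 44, which leaves two spare
     steps. *)
  do 2 exec; apply: (@reach_le _ _ _ (size cs * (8 * size s + 10)).+1); first by lia.
  by apply: IH => //; rewrite /upd /= ?V'1 ?V'4.
- by rewrite /score_diff big_nil.
Qed.

(** One term for each of the loops at addresses 14, 21 and 28; the 30 leaves room for straight-line
    code and exit tests. *)
Definition prog_time (k m : nat) := (4 * k + 6 * m + k * (8 * m + 10) + 30)%N.

Lemma exec_median (R : realType) (q : nat -> nat -> R) n (eps : R) k m s c0 cs w :
  let e := if eps < 2^-1 then eps else 2^-1 in
  (1 - e / 4) ^+ k < e / 4 ->
  (forall i, (i < k)%N -> e / 4 <= (1 - e / 4) ^+ i) ->
  k.+1%:R * (1 - e ^+ 2 / 200) ^+ m < e / 4 ->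
  (forall i, (i < m)%N -> e / 4 <= k.+1%:R * (1 - e ^+ 2 / 200) ^+ i) ->
  size s = m -> size cs = k ->
  reach q (fun s' => halted median_prog s' /\ nmem s' 0 = pick_best q s c0 cs)
    (prog_time k m) (init n eps (s ++ c0 :: cs ++ w)).
Proof.
move=> e endk ltk endm ltm szs szcs.
apply: (@reach_le _ _ _ ((4 * k + (6 * m + (k * (8 * m + 10)).+2).+4).+1).+4.+4.+4.+2)%N.
  by rewrite /prog_time; lia.
rewrite /init; do 4 exec; rewrite div1r.
(* Both branches of the computation of min(eps, 1/2) meet at address 5. *)
suff tail V : V 0%N = e -> V 1%N = 1 -> V 4%N = 0 ->
  reach q (fun s' => halted median_prog s' /\ nmem s' 0 = pick_best q s c0 cs)
    ((4 * k + (6 * m + (k * (8 * m + 10)).+2).+4).+1).+4.+4.+1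
    (State 5 (upd (fun=> 0%N) 0 n) V (s ++ c0 :: cs ++ w)).
  case: ifP => [lt|nlt].
    apply: (reach_le (leqnSn _)).
    by apply: tail => //; rewrite /upd /= /e lt.
  by exec; apply: tail => //; rewrite /upd /= addr0 /e nlt.
move=> V0 V1 V4; do 9 exec.
apply: (exec_count endk ltk _ (i := 0%N)) => //; last 1 first.
- by rewrite /prog_consts /upd /= ?V0 ?V1 ?V4 -expr2; split.
move=> V' cV' V'7; do 3 exec.
rewrite -szs -szcs; apply: (exec_sample endm ltm (s0 := [::])) => //.
- move=> N'' V'' sN'' [V''1 _ _ V''4 _] V''7; exec.
  rewrite szcs szs -szs -szcs; apply: exec_best => //; last by rewrite /upd /= szcs.
- by case: cV' => _ _ _ V'4 _; rewrite /upd /= V'7 V'4 addr0 mulr1.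
Qed.

(** * The selection rule on points *)

Lemma pick_best_map (R : realType) (T U : Type) (q : U -> U -> R) (q' : T -> T -> R)
    (f : T -> U) s b cs :
  (forall x y, q (f x) (f y) = q' x y) ->
  pick_best q (map f s) (f b) (map f cs) = f (pick_best q' s b cs).
Proof.
move=> qf; elim: cs b => //= c cs IH b.
have -> : score_diff q [seq f i | i <- s] (f c) (f b) = score_diff q' s c b.
  by rewrite /score_diff big_map; apply: eq_bigr => j _; rewrite !qf.
by case: ifP.
Qed.

Lemma score_diffE (R : realType) (T : Type) (q : T -> T -> R) s c b :
  score_diff q s c b = \sum_(j <- s) q c j - \sum_(j <- s) q b j.
Proof. by rewrite /score_diff sumrB. Qed.

(** By [score_diffE] every comparison is between two fixed sums, hence transitive, so the final
    incumbent is no worse than any earlier candidate. *)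
Lemma pick_bestP (R : realType) (T : eqType) (q : T -> T -> R) s b cs :
  pick_best q s b cs \in b :: cs /\
  {in b :: cs, forall c, score_diff q s (pick_best q s b cs) c <= 0}.
Proof.
elim: cs b => [|c cs IH] b /=.
  by rewrite mem_head; split=> // c; rewrite inE => /eqP ->; rewrite score_diffE subrr.
set b' := if _ then c else b; have [b'in b'le] := IH b'; split.
  move: b'in; rewrite !inE /b'; case: ifP => _ /orP[->|->]; rewrite ?orbT //.
have [bc bb] : score_diff q s b' c <= 0 /\ score_diff q s b' b <= 0.
  rewrite /b'; case: ifP; rewrite !score_diffE; first by lra.
  by move/negbT; rewrite -leNgt; lra.
have := b'le b' (mem_head _ _).
move=> le_b' x; rewrite !inE; case/or3P => [/eqP->|/eqP->|xcs].
- by move: le_b' bb; rewrite !score_diffE; lra.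
- by move: le_b' bc; rewrite !score_diffE; lra.
- by apply: b'le; rewrite inE xcs orbT.
Qed.

(** * Averages over random tapes *)

(** Expectation over t uniform draws. Taking functions of sequences instead of tuples allows tapes
    to be split and concatenated without casts; [tape_probE] links it to [tape_prob]. *)
Fixpoint tape_mean (R : realType) (n t : nat) (f : seq 'I_n -> R) : R :=
  if t is t'.+1 then
    n%:R^-1 * \sum_(x < n) tape_mean t' (fun w => f (x :: w))
  else f [::].

Lemma tape_mean_cat (R : realType) n a b (f : seq 'I_n -> R) :
  tape_mean (a + b) f = tape_mean a (fun u => tape_mean b (fun v => f (u ++ v))).
Proof.
elim: a f => //= a IH f; congr (_ * _).
by apply: eq_bigr => x _; rewrite IH.
Qed.

Lemma tape_mean_le (R : realType) n t (f g : seq 'I_n -> R) :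
  (forall w, size w = t -> f w <= g w) -> tape_mean t f <= tape_mean t g.
Proof.
elim: t f g => [|t IH] f g fg /=; first exact: fg.
apply: ler_wpM2l; first by rewrite invr_ge0.
by apply: ler_sum => x _; apply: IH => w sw; apply: fg; rewrite /= sw.
Qed.

Lemma eq_tape_mean (R : realType) n t (f g : seq 'I_n -> R) :
  (forall w, size w = t -> f w = g w) -> tape_mean t f = tape_mean t g.
Proof.
by move=> fg; apply/le_anti/andP; split; apply: tape_mean_le => w /fg ->.
Qed.

Lemma tape_mean_cst (R : realType) n t (c : R) : (0 < n)%N ->
  tape_mean t (fun _ : seq 'I_n => c) = c.
Proof.
move=> n0; elim: t => //= t ->.
by rewrite sumr_const card_ord -(mulr_natl c) mulrA mulVf ?mul1r // pnatr_eq0 -lt0n.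
Qed.

Lemma tape_meanM (R : realType) n t c (f : seq 'I_n -> R) :
  tape_mean t (fun w => c * f w) = c * tape_mean t f.
Proof.
elim: t f => //= t IH f; rewrite mulrCA; congr (_ * _); rewrite mulr_sumr.
by apply: eq_bigr => x _; rewrite IH.
Qed.

Lemma tape_mean_sum (R : realType) n t (I : Type) (r : seq I) (f : I -> seq 'I_n -> R) :
  tape_mean t (fun w => \sum_(i <- r) f i w) = \sum_(i <- r) tape_mean t (f i).
Proof.
elim: t f => //= t IH f; rewrite -mulr_sumr exchange_big /=; congr (_ * _).
by apply: eq_bigr => x _; rewrite IH.
Qed.

Lemma tape_meanD (R : realType) n t (f g : seq 'I_n -> R) :
  tape_mean t (fun w => f w + g w) = tape_mean t f + tape_mean t g.
Proof.
elim: t f g => //= t IH f g; rewrite -mulrDr -big_split; congr (_ * _).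
by apply: eq_bigr => x _; rewrite IH.
Qed.

Lemma tape_mean_exchange (R : realType) n a b (f : seq 'I_n -> seq 'I_n -> R) :
  tape_mean a (fun u => tape_mean b (fun v => f u v)) =
  tape_mean b (fun v => tape_mean a (fun u => f u v)).
Proof.
elim: a f => //= a IH f; rewrite tape_meanM tape_mean_sum; congr (_ * _).
by apply: eq_bigr => x _; rewrite IH.
Qed.

(** Independence of the draws; it serves both the exponential moments and the probability of missing
    a set. *)
Lemma tape_mean_prod (R : realType) n t (g : 'I_n -> R) :
  tape_mean t (fun w => \prod_(x <- w) g x) = (n%:R^-1 * \sum_(x < n) g x) ^+ t.
Proof.
elim: t => [|t IH] /=; first by rewrite big_nil.
rewrite exprS -IH -mulrA mulr_suml. congr (_ * _).
apply: eq_bigr => x _; rewrite -tape_meanM.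
by apply: eq_tape_mean => w _; rewrite big_cons.
Qed.

Lemma sum_tape_cons (R : realType) n t (f : seq 'I_n -> R) :
  \sum_(w : t.+1.-tuple 'I_n) f w = \sum_(x < n) \sum_(w : t.-tuple 'I_n) f (x :: w).
Proof.
rewrite pair_bigA (reindex (fun p : 'I_n * t.-tuple 'I_n => [tuple of p.1 :: p.2])) //=.
exists (fun w => (thead w, [tuple of behead w])) => [[x w] _|w _] /=.
  by rewrite theadE; congr (_, _); apply: val_inj.
by rewrite -tuple_eta.
Qed.

Lemma tape_meanE (R : realType) n t (f : seq 'I_n -> R) :
  tape_mean t f = (\sum_(w : t.-tuple 'I_n) f w) / n%:R ^+ t.
Proof.
elim: t f => [|t IH] f /=.
  rewrite divr1 (big_pred1 [tuple]) //= => w.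
  by apply/esym/eqP; rewrite tuple0.
rewrite sum_tape_cons exprS invfM mulrCA mulr_suml; congr (_ * _).
by apply: eq_bigr => x _; rewrite IH.
Qed.

Lemma tape_probE (R : realType) n t (E : pred (seq 'I_n)) :
  tape_prob R (fun w : t.-tuple 'I_n => E w) = tape_mean t (fun w => (E w)%:R).
Proof.
rewrite /tape_prob card_tuple card_ord natrX tape_meanE; congr (_ / _).
rewrite -sum1_card natr_sum big_mkcond; apply: eq_bigr => w _.
by rewrite inE; case: ifP.
Qed.

(** * Density of the good points *)

Lemma median1_exists (R : realType) n (d : 'I_n -> 'I_n -> R) :
  (0 < n)%N -> exists y, median1 d y.
Proof.
case: n d => // n d _.
case: (Order.TotalTheory.arg_minP (avg_dist d) (i0 := ord0) (P := xpredT)) => // y _ min_y.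
by exists y; apply/forallP => z; apply: min_y.
Qed.

Lemma many_good (R : realType) n (d : 'I_n -> 'I_n -> R) (e : R) y :
  ultrametric d -> 0 < e <= 2^-1 ->
  e / 4 * n%:R <= #|[set x | avg_dist d x <= (1 + e / 3) * avg_dist d y]|%:R.
Proof.
move=> [d0 deq dsym dmax] /andP[e0 e1]; set G := [set x | _].
rewrite leNgt; apply/negP => ltG.
have [x0G|/existsPn allG] := boolP [exists x, x \notin G]; last first.
  have GT : G = [set: 'I_n] by apply/setP => x; rewrite in_setT; apply/negPn/allG.
  move: ltG; rewrite GT cardsT card_ord; have : 0 <= n%:R :> R by [].
  nra.
case/existsP: x0G => x1 x1G.
case: (Order.TotalTheory.arg_minP (d y) (i0 := x1) (P := [pred x | x \notin G])) => //= x xG min_x.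
pose B := [set j | d y j < d y x].
have BG : (#|B|%:R <= #|G|%:R :> R).
  rewrite ler_nat; apply/subset_leq_card/subsetP => j; rewrite [in X in X -> _]inE => jB.
  by apply/negPn/negP => /min_x; rewrite leNgt jB.
have n0 : (0 < n%:R :> R) by rewrite ltr0n; case: (n) (x) => // -[].
have up : \sum_j d x j <= \sum_j d y j + #|B|%:R * d y x.
  have -> : #|B|%:R * d y x = \sum_(j in B) d y x by rewrite sumr_const mulr_natl.
  rewrite [\sum_(j in B) _]big_mkcond -big_split /=; apply: ler_sum => j _.
  have := dmax x y j; rewrite (dsym x y) inE; have := d0 y j.
  rewrite le_max => dyj; case: ifPn; last rewrite -leNgt.
    by move=> lt /orP[]; lra.
  by move=> lt /orP[]; lra.
have low : (n%:R - #|B|%:R) * d y x <= \sum_j d y j.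
  have -> : n%:R - #|B|%:R = #|~: B|%:R :> R.
    by apply/eqP; rewrite subr_eq -natrD addnC cardsC card_ord.
  have -> : #|~: B|%:R * d y x = \sum_(j in ~: B) d y x by rewrite sumr_const mulr_natl.
  rewrite big_mkcond; apply: ler_sum => j _; rewrite !inE -leNgt.
  by case: ifP => // _; apply: d0.
have : (1 + e / 3) * avg_dist d y < avg_dist d x by rewrite ltNge; move: xG; rewrite inE.
rewrite /avg_dist mulrCA ltr_pM2l ?invr_gt0 //.
set X := \sum_j d x j in up *; set Y := \sum_j d y j in up low *; set M := n%:R * d y x.
have bM : #|B|%:R * d y x <= e / 4 * M.
  by rewrite mulrA; apply: ler_wpM2r; rewrite ?d0 // (le_trans BG) ?ltW.
have M0 : 0 <= M by rewrite mulr_ge0.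
have : (1 - e / 4) * M <= Y by move: low bM; rewrite mulrBl -/M; lra.
(* As e <= 1/2, 1 - e/4 >= 7/8. Then e Y / 3 >= 7 e M / 24 >= e M / 4, whereas [lt], [up] and [bM]
   force e Y / 3 < e M / 4. *)
move=> low' lt; have : 7 / 8 * M <= Y by nra.
move=> low''; have : e * (7 / 8 * M) <= e * Y by rewrite ler_pM2l.
have : 0 <= e * M by rewrite mulr_ge0 // ltW.
lra.
Qed.

(** * Tail bounds for scores and for missed candidates *)

(* 1 - x <= expR (- x) gives expR x <= (1 - x)^-1. *)
Lemma expR_le_quad (R : realType) (x : R) : `|x| <= 2^-1 -> expR x <= 1 + x + 2 * x ^+ 2.
Proof.
rewrite ler_norml => /andP[xl xu].
have h := expR_ge1Dx (- x); have p := expR_gt0 x.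
have : expR x * expR (- x) = 1 by rewrite expRN divff ?gt_eqF.
have : expR x * (1 - x) <= expR x * expR (- x) by rewrite ler_pM2l.
(* For x <= 1/2, (1 + x + 2 x^2) (1 - x) = 1 + x^2 (1 - 2 x) >= 1. *)
nra.
Qed.

(* Chernoff bound for the increments d x j - d g j, which lie within d x g of 0. *)
Lemma score_tail (R : realType) n (d : 'I_n -> 'I_n -> R) (e : R) y g x m :
  ultrametric d -> 0 < e <= 2^-1 ->
  avg_dist d g <= (1 + e / 3) * avg_dist d y ->
  (1 + e) * avg_dist d y < avg_dist d x ->
  tape_mean m (fun s => (score_diff d s x g <= 0)%R%:R) <= (1 - e ^+ 2 / 200) ^+ m.
Proof.
move=> [d0 deq dsym dmax] /andP[e0 e1] gg bx.
have n0 : (0 < n%:R :> R) by rewrite ltr0n; case: (n) (x) => // -[].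
have tri a b c : d a c <= d a b + d b c.
  by have := dmax a b c; rewrite le_max => /orP[]; have := d0 a b; have := d0 b c; lra.
set D := d x g.
have Dle : D <= avg_dist d x + avg_dist d g.
  rewrite /avg_dist -mulrDr -big_split /= mulrC ler_pdivlMr //.
  have -> : D * n%:R = \sum_(j < n) D by rewrite sumr_const card_ord mulr_natr.
  by apply: ler_sum => j _; rewrite (dsym g j); apply: tri.
have y0 : 0 <= avg_dist d y by apply: mulr_ge0; [rewrite invr_ge0 | apply: sumr_ge0].
(* By [Dle] it suffices that (1 + e/5) avg(g) <= (1 - e/5) avg(x), which holds because (1 - e/5) (1
   + e) - (1 + e/5) (1 + e/3) = 4 e (1 - e) / 15 >= 0. *)
have mu : e * D / 5 <= avg_dist d x - avg_dist d g.
  have h1 : e * D <= e * (avg_dist d x + avg_dist d g) by rewrite ler_pM2l.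
  have h2 : (1 + e / 5) * avg_dist d g <= (1 + e / 5) * ((1 + e / 3) * avg_dist d y).
    by rewrite ler_pM2l //; lra.
  have h3 : (1 - e / 5) * ((1 + e) * avg_dist d y) <= (1 - e / 5) * avg_dist d x.
    by rewrite ler_pM2l ?ltW; lra.
  have h4 : 0 <= e * (1 - e) * avg_dist d y by apply: mulr_ge0 => //; apply: mulr_ge0; lra.
  lra.
have D0 : 0 < D.
  rewrite lt_neqAle d0 andbT eq_sym; apply/negP => /eqP /deq xg.
  have := mulr_ge0 (ltW e0) y0; move: gg bx; rewrite xg; lra.
(* With the scale e / 20 the mean of z is at least e^2 / 100 and 2 z^2 is at most e^2 / 200, so the
   mean of exp(-z) is at most 1 - e^2 / 200. *)
pose z j := e / 20 * ((d x j - d g j) / D).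
have zb j : `|z j| <= e / 20.
  rewrite /z normrM ger0_norm; last by lra.
  apply: ler_piMr; first by lra.
  rewrite normrM normfV (gtr0_norm D0) ler_pdivrMr // mul1r.
  rewrite ler_norml; have := tri x g j; have := tri g x j; rewrite (dsym g x) -/D; lra.
(* Markov step: a nonpositive score difference makes the sum of the -z nonnegative, so its
   exponential dominates the indicator. *)
apply: (@le_trans _ _ (tape_mean m (fun s => \prod_(j <- s) expR (- z j)))).
  apply: tape_mean_le => s _; rewrite -expR_sum.
  case: (lerP _ 0) => [le0|_]; last exact: expR_ge0.
  rewrite -[leLHS]expR0 ler_expR sumrN oppr_ge0 /z -mulr_sumr -mulr_suml -/(score_diff d s x g).
  by rewrite pmulr_rle0 ?divr_gt0 // pmulr_lle0 // invr_gt0.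
rewrite tape_mean_prod; apply: lerXn2r; rewrite ?nnegrE.
- by apply: mulr_ge0; [rewrite invr_ge0 | apply: sumr_ge0 => j _; apply: expR_ge0].
- nra.
rewrite mulrC ler_pdivrMr //.
apply: (@le_trans _ _ (\sum_(j < n) (1 + e ^+ 2 / 200 - z j))).
  apply: ler_sum => j _; have := zb j; rewrite ler_norml => /andP[zl zu].
  apply: (le_trans (expR_le_quad _)); first by rewrite normrN; have := zb j; lra.
  nra.
rewrite sumrB sumr_const card_ord /z -mulr_sumr -mulr_suml sumrB.
rewrite -mulr_natr.
have -> : \sum_(j < n) d x j - \sum_(j < n) d g j = n%:R * (avg_dist d x - avg_dist d g).
  by rewrite /avg_dist -mulrBr mulVKf // gt_eqF.
have : e / 5 <= (avg_dist d x - avg_dist d g) / D by rewrite ler_pdivlMr //; lra.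
set a := _ / D => ea; rewrite -[n%:R * _ / D]mulrA -/a.
have : 0 <= e * n%:R * (a - e / 5).
  by apply: mulr_ge0; [apply: mulr_ge0; rewrite ltW | rewrite subr_ge0].
lra.
Qed.

Lemma no_hit (R : realType) n (G : {set 'I_n}) (p : R) k : (0 < n)%N ->
  p * n%:R <= #|G|%:R ->
  tape_mean k (fun c => (all [predC G] c)%:R) <= (1 - p) ^+ k.
Proof.
move=> n0 pG.
rewrite (@eq_tape_mean _ _ _ _ (fun c => \prod_(x <- c) (x \notin G)%:R)); last first.
  by move=> c _; elim: c => [|x c IH]; rewrite ?big_nil ?big_cons //= -IH -natrM mulnb.
rewrite tape_mean_prod -natr_sum.
have -> : (\sum_(x < n) (x \notin G) = #|~: G|)%N.
  by rewrite -sum1_card big_mkcond [in RHS]big_mkcond; apply: eq_bigr => x _; rewrite inE; case: ifP.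
have n0' : (0 < n%:R :> R) by rewrite ltr0n.
have -> : #|~: G|%:R = n%:R - #|G|%:R :> R.
  by apply/eqP; rewrite eq_sym subr_eq -natrD addnC cardsC card_ord.
have Gn : (#|G|%:R <= n%:R :> R) by rewrite ler_nat -[leqRHS]card_ord max_card.
rewrite mulrC; apply: lerXn2r; rewrite ?nnegrE ?divr_ge0 ?subr_ge0 //.
- by rewrite -(ler_pM2r n0') mul1r (le_trans pG).
- by rewrite ler_pdivrMr // mulrBl mul1r lerB.
Qed.

(** * Union bound for the success probability *)

(** The success event read off the tape alone, without the machine. *)
Definition draw_ok (R : realType) n (d : 'I_n -> 'I_n -> R) (e : R) (m k : nat)
    (w : seq 'I_n) : bool :=
  if drop m w is c0 :: cs
  then approx_median1 d (1 + e) (pick_best d (take m w) c0 (take k cs)) else false.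

(** There are two ways to fail: no candidate lies in G, or some bad candidate scores no worse than
    the first candidate in G. The first term bounds the former, the second sums [score_tail] over
    the k + 1 candidates. *)
Lemma draw_ok_mean (R : realType) n (d : 'I_n -> 'I_n -> R) (e : R) k m r :
  (0 < n)%N -> ultrametric d -> 0 < e <= 2^-1 ->
  1 - ((1 - e / 4) ^+ k.+1 + k.+1%:R * (1 - e ^+ 2 / 200) ^+ m) <=
  tape_mean (m + (k.+1 + r)) (fun w => (draw_ok d e m k w)%:R).
Proof.
move=> n0 ud e01; have [y ymed] := median1_exists d n0.
pose G := [set x | avg_dist d x <= (1 + e / 3) * avg_dist d y].
pose bad x := (1 + e) * avg_dist d y < avg_dist d x.
(* The default [y] is harmless: [err] vanishes when no candidate lies in G. *)
pose g c := nth y c (find (mem G) c).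
pose ok s c := if c is c0 :: cs then approx_median1 d (1 + e) (pick_best d s c0 cs) else false.
pose err c s : R := \sum_(x <- c) ((has (mem G) c && bad x) && (score_diff d s x (g c) <= 0))%:R.
have -> : tape_mean (m + (k.+1 + r)) (fun w => (draw_ok d e m k w)%:R) =
    tape_mean m (fun s => tape_mean k.+1 (fun c => (ok s c)%:R)) :> R.
  rewrite tape_mean_cat; apply: eq_tape_mean => s sm.
  rewrite tape_mean_cat; apply: eq_tape_mean => -[//|c0 cs] [scs].
  rewrite -[RHS](tape_mean_cst r _ n0); apply: eq_tape_mean => v _.
  by rewrite /draw_ok -sm drop_size_cat // take_size_cat //= -scs take_size_cat.
have pointwise s c : size c = k.+1 -> 1 <= (ok s c)%:R + ((all [predC G] c)%:R + err c s).
  move=> sc; have err0 : 0 <= err c s by apply: sumr_ge0.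
  have [hasG|] := boolP (has (mem G) c); last first.
    by rewrite -all_predC => ->; rewrite ler_wpDl // ler_wpDr.
  case: c sc hasG err0 => // c0 cs _ hasG err0; rewrite [ok _ _]/=.
  have gG : g (c0 :: cs) \in G by apply: nth_find.
  have gin : g (c0 :: cs) \in c0 :: cs by rewrite mem_nth // -has_find.
  have [] := pick_bestP d s c0 cs; set b := pick_best d s c0 cs => bin /(_ _ gin) ble.
  have [badb|] := boolP (bad b).
    suff : 1 <= err (c0 :: cs) s by move=> le1; rewrite !ler_wpDl.
    by rewrite /err (big_rem b) // hasG badb ble ler_wpDr // sumr_ge0.
  rewrite /bad -leNgt => leb.
  have -> : approx_median1 d (1 + e) b by apply/existsP; exists y; rewrite ymed.
  by rewrite lerDl addr_ge0.
have total : 1 <= tape_mean m (fun s => tape_mean k.+1 (fun c => (ok s c)%:R)) +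
    (tape_mean k.+1 (fun c => (all [predC G] c)%:R) +
     tape_mean k.+1 (fun c => tape_mean m (fun s => err c s))).
  (* The candidates are fixed before averaging over the samples, as [score_tail] requires. *)
  rewrite [X in _ + (_ + X)]tape_mean_exchange.
  rewrite -[X in _ + (X + _)](tape_mean_cst m _ n0) -!tape_meanD.
  rewrite -[leLHS](tape_mean_cst m _ n0); apply: tape_mean_le => s _.
  rewrite -!tape_meanD -[leLHS](tape_mean_cst k.+1 _ n0).
  by apply: tape_mean_le => c; apply: pointwise.
have errle : tape_mean k.+1 (fun c => tape_mean m (fun s => err c s)) <=
    k.+1%:R * (1 - e ^+ 2 / 200) ^+ m.
  rewrite -[leRHS](tape_mean_cst k.+1 _ n0); apply: tape_mean_le => c sc.
  rewrite tape_mean_sum mulr_natl -sc -count_predT -iter_addr_0 -big_const_seq.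
  rewrite big_seq [leRHS]big_seq; apply: ler_sum => x xc.
  have q0 : 0 <= (1 - e ^+ 2 / 200) ^+ m by apply: exprn_ge0; case/andP: e01; nra.
  case: (boolP (has _ c && bad x)) => [/andP[hasG badx]|_] /=; last by rewrite tape_mean_cst.
  apply: score_tail badx => //.
  have : g c \in G by apply: nth_find.
  by rewrite inE.
have missle := no_hit k.+1 n0 (many_good y ud e01).
lra.
Qed.

(** * Loop lengths and running time *)

Lemma decay_time (R : realType) (a x theta : R) i :
  0 < theta -> 0 < a -> 0 < x < 1 -> theta <= a * (1 - x) ^+ i ->
  x * i%:R <= ln (a / theta).
Proof.
move=> t0 a0 /andP[x0 x1] le_theta.
have : theta <= a * expR (- (i%:R * x)).
  apply: (le_trans le_theta); rewrite ler_pM2l // -mulrN expRM_natl.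
  by apply: lerXn2r (expR_ge1Dx _); rewrite nnegrE ?expR_ge0 // subr_ge0 ltW.
rewrite -ler_ln ?posrE ?mulr_gt0 ?expR_gt0 // lnM ?posrE ?expR_gt0 // expRK.
by rewrite ln_div ?posrE // mulrC; lra.
Qed.

(** The least such k is the exact number of rounds of a loop. Its predecessor has not passed the
    threshold, so [decay_time] bounds it; the extra x pays for the last round. *)
Lemma first_below (R : realType) (a x theta : R) :
  0 < theta <= a -> 0 < x < 1 ->
  exists k, [/\ a * (1 - x) ^+ k < theta,
    forall i, (i < k)%N -> theta <= a * (1 - x) ^+ i &
    x * k%:R <= x + ln (a / theta)].
Proof.
move=> /andP[t0 ta] x01; have a0 := lt_le_trans t0 ta.
have ex : exists k, a * (1 - x) ^+ k < theta.
  exists (Num.truncn (ln (a / theta) / x)).+1; rewrite ltNge; apply/negP => /(decay_time t0 a0 x01).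
  case/andP: x01 => x0 _; rewrite mulrC -ler_pdivlMr // leNgt.
  by rewrite truncnS_gt.
case: (ex_minnP ex) => k endk mink; exists k; split => //.
  by move=> i; rewrite ltnNge leNgt; apply: contra => /mink.
case: k endk mink => [|k] endk mink.
  case/andP: x01 => x0 _; rewrite mulr0 addr_ge0 ?(ltW x0) ?ln_ge0 //.
  by rewrite ler_pdivlMr // mul1r.
rewrite -natr1 mulrDr mulr1 addrC lerD2l; apply: decay_time => //.
by rewrite leNgt; apply/negP => /mink; rewrite ltnn.
Qed.

Lemma ln_le_mul (R : realType) (a u : R) c :
  0 < a -> 0 < u -> a <= u ^+ c -> ln a <= c%:R * ln u.
Proof.
by move=> a0 u0 au; rewrite mulr_natl -lnXn // ler_ln ?posrE ?exprn_gt0.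
Qed.

Lemma prog_time_le_mul k m :
  (0 < k)%N -> (0 < m)%N -> (prog_time k m <= 58 * (k * m))%N.
Proof.
move=> k0 m0; rewrite /prog_time mulnDr mulnCA.
have := leq_pmulr k m0; have := leq_pmull m k0; have : (0 < k * m)%N by rewrite muln_gt0 k0.
by set km := (k * m)%N; lia.
Qed.

(** The 58 = 4 + 6 + 8 + 10 + 30 sums the coefficients of [prog_time]; with u = 1/e and L = ln u, 13
    bounds k / (u L) and 1801 bounds m / (u^2 L). *)
Definition time_factor (R : realType) : R := 58 * 13 * 1801.

Lemma prog_time_le (R : realType) (e : R) k m :
  0 < e <= 2^-1 -> (0 < k)%N -> (0 < m)%N ->
  e / 4 * k%:R <= e / 4 + ln (1 / (e / 4)) ->
  e ^+ 2 / 200 * m%:R <= e ^+ 2 / 200 + ln (k.+1%:R / (e / 4)) ->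
  (prog_time k m)%:R <= time_factor R * (ln (1 / e) ^+ 2 / e ^+ 3).
Proof.
move=> /andP[e0 e1] k0 m0 kle mle.
set L := ln (1 / e); pose u := e^-1; have u0 : 0 < u by rewrite invr_gt0.
have eu : e * u = 1 by rewrite mulfV // gt_eqF.
have u2 : 2 <= u by nra.
have Lu : L = ln u by rewrite /L div1r.
have Lge : 2^-1 <= L.
  have : ln (1 + (e - 1)) <= e - 1 by apply: le_ln1Dx; lra.
  by rewrite addrC subrK Lu lnV ?posrE //; lra.
have Lle : L <= u by rewrite Lu ltW // ln_sublinear.
have uL1 : 1 <= u * L by nra.
have kL : k%:R <= 13 * (u * L).
  have : ln (1 / (e / 4)) <= 3%:R * ln u.
    apply: ln_le_mul => //; first by rewrite divr_gt0 ?divr_gt0.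
    by rewrite div1r invf_div -/u !exprS; nra.
  rewrite -Lu => h; have : u * (e / 4 * k%:R) <= u * (e / 4 + 3 * L).
    by rewrite ler_pM2l //; lra.
  rewrite mulrDr !mulrA [u * e]mulrC eu; lra.
have mL : m%:R <= 1801 * (u ^+ 2 * L).
  (* Since k + 1 <= 14 u^2, the argument is at most 56 u^3, and 56 <= 2^6 <= u^6. *)
  have : ln (k.+1%:R / (e / 4)) <= 9%:R * ln u.
    apply: ln_le_mul => //; first by rewrite divr_gt0 ?divr_gt0.
    rewrite invf_div mulrCA mulrA -/u.
    have k1 : k.+1%:R <= 14 * u ^+ 2 by rewrite -natr1 expr2; nra.
    have u6 : 56 <= u ^+ 6.
      have : 2 ^+ 6 <= u ^+ 6 by apply: lerXn2r u2; rewrite nnegrE; lra.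
      lra.
    rewrite (_ : u ^+ 9 = u ^+ 6 * (u * u ^+ 2)); last by ring.
    apply: (@le_trans _ _ (56 * (u * u ^+ 2))).
      have : u * k.+1%:R <= u * (14 * u ^+ 2) by rewrite ler_pM2l.
      lra.
    by rewrite ler_pM2r // mulr_gt0 // exprn_gt0.
  rewrite -Lu => h; have u20 : 0 < u ^+ 2 by rewrite exprn_gt0.
  have eu2 : u ^+ 2 * e ^+ 2 = 1 by rewrite -exprMn mulrC eu expr1n.
  have : u ^+ 2 * (e ^+ 2 / 200 * m%:R) <= u ^+ 2 * (e ^+ 2 / 200 + 9 * L).
    by rewrite ler_pM2l //; lra.
  have : 1 <= u ^+ 2 * L by rewrite expr2; nra.
  have -> : u ^+ 2 * (e ^+ 2 / 200 * m%:R) = u ^+ 2 * e ^+ 2 * (m%:R / 200) by ring.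
  have -> : u ^+ 2 * (e ^+ 2 / 200 + 9 * L) = u ^+ 2 * e ^+ 2 / 200 + 9 * (u ^+ 2 * L) by ring.
  by rewrite eu2; lra.
apply: (@le_trans _ _ (58 * (k%:R * m%:R))).
  by rewrite -!natrM ler_nat prog_time_le_mul.
have -> : time_factor R * (L ^+ 2 / e ^+ 3) =
    58 * (13 * (u * L) * (1801 * (u ^+ 2 * L))).
  by rewrite /time_factor -exprVn -/u; ring.
by rewrite ler_pM2l //; apply: ler_pM.
Qed.

(** * From runs of the machine to the final statement *)

Lemma step_halted (R : realType) (q : nat -> nat -> R) prog s :
  halted prog s -> step q prog s = s.
Proof. by case: s => l N V w; rewrite /halted /step /=; case: fetch. Qed.

(** Halted states are fixed by [step], so a state reached within T steps is still there after
    exactly T. *)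
Lemma reach_halted (R : realType) (q : nat -> nat -> R) b T s :
  reach q (fun s' => halted median_prog s' /\ nmem s' 0 = b) T s ->
  halted median_prog (iter T (step q median_prog) s) /\
  nmem (iter T (step q median_prog) s) 0 = b.
Proof.
case=> j jT [hj bj]; rewrite -(subnK jT) iterD.
suff -> s' i : halted median_prog s' -> iter i (step q median_prog) s' = s' by [].
by move=> hs'; elim: i => //= i ->; apply: step_halted.
Qed.

Lemma oracle_val (R : realType) n (d : 'I_n -> 'I_n -> R) x y :
  oracle d (val x) (val y) = d x y.
Proof. by rewrite /oracle !valK. Qed.

Lemma approx_median1_mono (R : realType) n (d : 'I_n -> 'I_n -> R) (a b : R) x :
  ultrametric d -> a <= b -> approx_median1 d a x -> approx_median1 d b x.
Proof.
move=> [d0 _ _ _] ab /existsP[y /andP[ymed le_a]].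
apply/existsP; exists y; rewrite ymed (le_trans le_a) // ler_wpM2r //.
by apply: mulr_ge0; [rewrite invr_ge0 | apply: sumr_ge0].
Qed.

Theorem theorem3 (R : realType) :
  exists (prog : program) (C : R),
    forall eps : R, 0 < eps ->
    exists t : nat,
      t%:R <= C * (ln (1 / eps) ^+ 2 / eps ^+ 3 + 1) /\
      forall (n : nat) (d : 'I_n -> 'I_n -> R),
        (0 < n)%N -> ultrametric d ->
        (forall w : t.-tuple 'I_n, halted prog (run d prog eps w)) /\
        1 - eps < tape_prob R (fun w : t.-tuple 'I_n =>
          outputs (approx_median1 d (1 + eps)) (run d prog eps w)).
Proof.
exists median_prog, (8 * time_factor R) => eps eps0.
pose e := if eps < 2^-1 then eps else 2^-1.
have e01 : 0 < e <= 2^-1 by rewrite /e; case: (ltP eps) => [lt|_]; apply/andP; split; lra.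
have ele : e <= eps by rewrite /e; case: (ltP eps).
have /andP[e0 e1] := e01.
have [k [endk ltk kle]] : exists k, [/\ 1 * (1 - e / 4) ^+ k < e / 4,
    forall i, (i < k)%N -> e / 4 <= 1 * (1 - e / 4) ^+ i &
    e / 4 * k%:R <= e / 4 + ln (1 / (e / 4))].
  by apply: first_below; apply/andP; split; lra.
have [m [endm ltm mle]] : exists m, [/\ k.+1%:R * (1 - e ^+ 2 / 200) ^+ m < e / 4,
    forall i, (i < m)%N -> e / 4 <= k.+1%:R * (1 - e ^+ 2 / 200) ^+ i &
    e ^+ 2 / 200 * m%:R <= e ^+ 2 / 200 + ln (k.+1%:R / (e / 4))].
  apply: first_below; last by rewrite expr2; nra.
  have : 1 <= k.+1%:R :> R by rewrite ler1n.
  by lra.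
have k0 : (0 < k)%N by case: (k) endk => //; rewrite expr0; lra.
have m0 : (0 < m)%N.
  case: (m) endm => //; rewrite expr0; have : 1 <= k.+1%:R :> R by rewrite ler1n.
  by lra.
exists (prog_time k m); split.
  apply: (le_trans (prog_time_le e01 k0 m0 kle mle)).
  have tf0 : 0 < time_factor R by rewrite /time_factor; lra.
  have pow_ge0 : 0 <= ln (1 / eps) ^+ 2 / eps ^+ 3.
    by rewrite divr_ge0 ?sqr_ge0 // exprn_ge0 // ltW.
  (* For eps >= 1/2 the left side is the constant 8 ln(2)^2 <= 8, absorbed by the summand 1. *)
  suff le8 : ln (1 / e) ^+ 2 / e ^+ 3 <= 8 * (ln (1 / eps) ^+ 2 / eps ^+ 3 + 1).
    by rewrite (mulrC 8) -(mulrA (time_factor R)) ler_pM2l.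
  rewrite /e; case: (ltP eps) => _; first by lra.
  have ln2 : 0 <= ln (2 : R) <= 1.
    by rewrite ln_ge0 ?ler1n //; have := @le_ln1Dx R 1; rewrite (_ : 1 + 1 = 2) //; apply; lra.
  have -> : (1 / 2^-1 : R) = 2 by rewrite div1r invrK.
  have -> : ln 2 ^+ 2 / 2^-1 ^+ 3 = 8 * (ln 2 ^+ 2) :> R by rewrite exprVn invrK; ring.
  have : ln 2 ^+ 2 <= 1 :> R by rewrite expr_le1; case/andP: ln2.
  lra.
have {}endk : (1 - e / 4) ^+ k < e / 4 by rewrite mul1r in endk.
have {}ltk i : (i < k)%N -> e / 4 <= (1 - e / 4) ^+ i by move/ltk; rewrite mul1r.
move=> n d n0 ud.
have exec s c0 cs rest : size s = m -> size cs = k ->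
  halted median_prog (iter (prog_time k m) (step (oracle d) median_prog)
    (init n eps [seq val i | i <- s ++ c0 :: cs ++ rest])) /\
  nmem (iter (prog_time k m) (step (oracle d) median_prog)
    (init n eps [seq val i | i <- s ++ c0 :: cs ++ rest])) 0 = val (pick_best d s c0 cs).
  move=> ss scs; apply: reach_halted; rewrite map_cat /= map_cat.
  rewrite -(pick_best_map s c0 cs (oracle_val d)).
  by apply: exec_median; rewrite ?size_map.
(* The tape has as many letters as there are steps, which is at least m + k + 1. *)
have split_tape (w : seq 'I_n) : size w = prog_time k m ->
  exists s c0 cs rest, [/\ size s = m, size cs = k & w = s ++ c0 :: cs ++ rest].
  move=> sw; case dw: (drop m w) => [|c0 v].
    by move: (size_drop m w); rewrite dw sw /prog_time /=; lia.
  exists (take m w), c0, (take k v), (drop k v); split.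
  - by rewrite size_takel // sw /prog_time; lia.
  - rewrite size_takel //; move: (size_drop m w); rewrite dw sw /prog_time /=; lia.
  - by rewrite cat_take_drop -dw cat_take_drop.
split=> [w|].
  rewrite /run; case: (split_tape w (size_tuple w)) => s [c0 [cs [rest [ss scs ->]]]].
  by case: (exec s c0 cs rest ss scs).
pose E (w : seq 'I_n) := outputs (approx_median1 d (1 + eps))
  (iter (prog_time k m) (step (oracle d) median_prog) (init n eps [seq val i | i <- w])).
rewrite [ltRHS](tape_probE R (prog_time k m) E).
have [r tr] : exists r, prog_time k m = (m + (k.+1 + r))%N.
  by exists (prog_time k m - (m + k.+1))%N; rewrite /prog_time; lia.
apply: (@lt_le_trans _ _ (tape_mean (prog_time k m) (fun w => (draw_ok d e m k w)%:R))).
  (* Each failure term is below e/4, so the total is below e/2 < eps. *)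
  rewrite tr; apply: lt_le_trans (draw_ok_mean k m r n0 ud e01).
  have : (1 - e / 4) ^+ k.+1 <= (1 - e / 4) ^+ k.
    by rewrite exprS ler_piMl ?exprn_ge0 //; lra.
  lra.
apply: tape_mean_le => w /split_tape [s [c0 [cs [rest [ss scs ->]]]]].
rewrite ler_nat /draw_ok -ss drop_size_cat // take_size_cat // -scs take_size_cat //.
case ok: approx_median1 => //; rewrite /E /outputs.
have [_ ->] := exec s c0 cs rest ss scs.
rewrite valK.
by rewrite (approx_median1_mono ud _ ok) // lerD2l.
Qed.
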